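(* Let $0<\alpha\le1$, $\nu>0$, $\xi>0$, and let $\Phi^{(n)}(t)$ ($n,t\in\mathbb{N}_0$) be the state probabilities of the Prabhakar discrete-time process (PDTP) with parameters $\alpha,\nu,\xi$. For $\mu\ge0$ and $k\in\mathbb{N}_0$ put $$\mathcal{P}_{\mu}(k)=\begin{cases}\displaystyle\frac{\xi^{\mu}}{k!}\sum_{m=0}^{\infty}\frac{(-1)^m(\mu)_m\xi^m}{m!}\,\frac{\Gamma(\alpha(m+\mu)+1+k)}{\Gamma(\alpha(m+\mu)+1)},&0<\xi<1,\\[2ex]\displaystyle\frac{(-1)^k}{k!}\sum_{m=0}^{\infty}\frac{(-1)^m(\mu)_m\xi^{-m}}{m!}\,(\alpha m-1)(\alpha m-2)\cdots(\alpha m-k),&\xi>1,\end{cases}$$ and $\mathcal{P}_\mu(k)=0$ for $k<0$. Then for $\xi\in(0,1)\cup(1,\infty)$ and all $n,t\in\mathbb{N}_0$, $$\Phi^{(n)}(t)=\mathcal{P}_{n\nu}(t-n)-\mathcal{P}_{(n+1)\nu}(t-n-1).$$ In particular $\Phi^{(n)}(t)=0$ for $t<n$, and $\Phi^{(n)}(0)=\delta_{n0}$.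
   Context: $\mathbb{N}_0=\{0,1,2,\dots\}$; $(c)_0=1$, $(c)_m=c(c+1)\cdots(c+m-1)$; an empty product is $1$. The PDTP with parameters $\alpha,\nu,\xi$ is the discrete-time renewal process with arrival times $J_0=0$, $J_n=\sum_{j=1}^nZ_j$, where the $Z_j$ are i.i.d. $\{1,2,\dots\}$-valued with generating function $\mathbb{E}u^{Z_j}=\frac{\xi^{\nu}u}{(\xi+(1-u)^{\alpha})^{\nu}}$, $|u|\le 1$ (principal branches). Its state probabilities are the probabilities of exactly $n$ arrivals in $[0,t]$: $\Phi^{(n)}(t)=\mathbb{P}(J_n\le t<J_{n+1})$. *)

(* Defs.v *)
From HB Require Import structures.
From mathcomp Require Import all_boot all_order all_algebra.
From mathcomp Require Import finmap.
From mathcomp Require Import complex.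
From mathcomp Require Import all_classical all_reals all_analysis.

Set Implicit Arguments.
Unset Strict Implicit.
Unset Printing Implicit Defensive.

Import Order.TTheory GRing.Theory Num.Theory.
Import numFieldNormedType.Exports.
Import ComplexField.Normc.

Local Open Scope classical_set_scope.
Local Open Scope complex_scope.
Local Open Scope ring_scope.

(* Principal argument, in ]-pi, pi]. Its value at 0 is immaterial below: in
   [cpow 0 a] with a <> 0 the modulus factor [0 `^ a] vanishes. *)
Definition carg (R : realType) (z : R[i]) : R :=
  let theta := acos (complex.Re z / normc z) in
  if 0 <= complex.Im z then theta else - theta.

(* Principal branch of z ^ a for a real exponent a. *)
Definition cpow (R : realType) (z : R[i]) (a : R) : R[i] :=
  (normc z `^ a)%:C * (cos (a * carg z) +i* sin (a * carg z)).

(* Euler's integral; it is the Gamma function for x > 0, the only range used. *)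
Definition Gamma (R : realType) (x : R) : R :=
  \int[@lebesgue_measure R]_(s in `]0, +oo[) (s `^ (x - 1) * expR (- s)).

(* The rising factorial (c)_m. *)
Definition pochhammer (R : realType) (c : R) (m : nat) : R :=
  \prod_(i < m) (c + i%:R).

Definition mutually_independent (R : realType) (d d' : measure_display)
    (Omega : measurableType d) (T : measurableType d')
    (P : probability Omega R) (Z : nat -> {RV P >-> T}) : Prop :=
  forall (J : {fset nat}) (A : nat -> set T),
    (forall j, measurable (A j)) ->
    P (\bigcap_(j in [set` J]) (Z j @^-1` A j)) =
    (\prod_(j <- J) P (Z j @^-1` A j))%E.

Definition identically_distributed (R : realType) (d d' : measure_display)
    (Omega : measurableType d) (T : measurableType d')
    (P : probability Omega R) (Z : nat -> {RV P >-> T}) : Prop :=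
  forall (i j : nat) (A : set T), measurable A ->
    distribution P (Z i) A = distribution P (Z j) A.

(* E u^Z = g u on the closed complex unit disc; the expectation of a
   complex-valued variable is taken on real and imaginary parts. *)
Definition has_generating_function (R : realType) (d : measure_display)
    (Omega : measurableType d) (P : probability Omega R)
    (Z : {RV P >-> nat}) (g : R[i] -> R[i]) : Prop :=
  forall u : R[i], `|u| <= 1 ->
    'E_P[fun w => complex.Re (u ^+ Z w)%R]%E = (complex.Re (g u))%:E /\
    'E_P[fun w => complex.Im (u ^+ Z w)%R]%E = (complex.Im (g u))%:E.

Definition pdtp_gf (R : realType) (alpha nu xi : R) (u : R[i]) : R[i] :=
  (xi `^ nu)%:C * u / cpow (xi%:C + cpow (1 - u) alpha) nu.

(* The waiting times Z_1, Z_2, ... are [Z 0], [Z 1], ... *)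
Record is_PDTP (R : realType) (d : measure_display) (Omega : measurableType d)
    (P : probability Omega R) (alpha nu xi : R)
    (Z : nat -> {RV P >-> nat}) : Prop := {
  pdtp_positive : forall j w, (0 < Z j w)%N;
  pdtp_independent : mutually_independent Z;
  pdtp_identical : identically_distributed Z;
  pdtp_generating : forall j,
    has_generating_function (Z j) (pdtp_gf alpha nu xi) }.

Definition arrival (R : realType) (d : measure_display)
    (Omega : measurableType d) (P : probability Omega R)
    (Z : nat -> {RV P >-> nat}) (n : nat) (w : Omega) : nat :=
  (\sum_(j < n) Z j w)%N.

Definition state_probability (R : realType) (d : measure_display)
    (Omega : measurableType d) (P : probability Omega R)
    (Z : nat -> {RV P >-> nat}) (n t : nat) : \bar R :=
  P [set w | (arrival Z n w <= t < arrival Z n.+1 w)%N].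

Definition calP_term_lt1 (R : realType) (alpha xi mu : R) (k m : nat) : R :=
  (-1) ^+ m * pochhammer mu m * xi ^+ m / m`!%:R *
  (Gamma (alpha * (m%:R + mu) + 1 + k%:R) / Gamma (alpha * (m%:R + mu) + 1)).

Definition calP_term_gt1 (R : realType) (alpha xi mu : R) (k m : nat) : R :=
  (-1) ^+ m * pochhammer mu m * xi ^- m / m`!%:R *
  \prod_(1 <= i < k.+1) (alpha * m%:R - i%:R).

(* [limn] is a total operator, so the value of [calP] is meaningful only when
   the series converges. The value at xi = 1 is irrelevant. *)
Definition calP (R : realType) (alpha xi mu : R) (k : int) : R :=
  match k with
  | Posz k =>
      if xi < 1
      then xi `^ mu / k`!%:R * limn (series (calP_term_lt1 alpha xi mu k))
      else (-1) ^+ k / k`!%:R * limn (series (calP_term_gt1 alpha xi mu k))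
  | Negz _ => 0
  end.

(* Main.v *)
Require Import Defs.
From HB Require Import structures.
From mathcomp Require Import all_boot all_order all_algebra.
From mathcomp Require Import finmap.
From mathcomp Require Import complex.
From mathcomp Require Import all_classical all_reals all_analysis.
From mathcomp Require Import measurable_realfun zify ring lra.

Set Implicit Arguments.
Unset Strict Implicit.
Unset Printing Implicit Defensive.

Import Order.TTheory GRing.Theory Num.Theory.
Import numFieldNormedType.Exports.

Local Open Scope classical_set_scope.
Local Open Scope ring_scope.

(** Put [u = - x] with [0 <= x] small. The generating function of
    [t |-> P (J_n <= t)] is [(E u^Z)^n / (1 - u) = u^n G(u)], where
    [G(u) = xi^mu / ((1 - u) (xi + (1 - u)^alpha)^mu)] and [mu = n nu].
    Factoring out the larger of [xi] and [(1 - u)^alpha] near [u = 0], the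
    binomial series turns [G] into an absolutely convergent mixture of powers
    [(1 - u)^(- c_m)], with [c_m = alpha (m + mu) + 1] if [xi < 1] and
    [c_m = 1 - alpha m] if [xi > 1], and the coefficients of these powers are
    [(c_m)_k / k!]. Instead of exchanging two infinite sums, everything is
    compared modulo [O(x^K)] by means of Taylor polynomials, which determines
    the coefficients of degree [< K]. On the half-line [u <= 0] the Taylor
    remainder of [(1 - u)^(- c)] is bounded by its first omitted term up to a
    factor that is geometric in [m]. *)

(** * Rising factorials and the Taylor remainder of (1 + x)^(- c) on the half-line *)

Lemma pochhammerSl (R : realType) (c : R) m :
  pochhammer c m.+1 = c * pochhammer (c + 1) m.
Proof.
rewrite /pochhammer big_ord_recl addr0; congr (_ * _).
by apply: eq_bigr => i _; rewrite lift0 -natr1 -addrA (addrC 1).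
Qed.

Lemma pochhammerS (R : realType) (c : R) m :
  pochhammer c m.+1 = pochhammer c m * (c + m%:R).
Proof. by rewrite /pochhammer big_ord_recr. Qed.

Lemma pochhammer_ge0 (R : realType) (c : R) m : 0 <= c -> 0 <= pochhammer c m.
Proof. by move=> c0; apply: prodr_ge0 => i _; rewrite addr_ge0. Qed.

(** Both [g + f] and [g - f] vanish at 0 and have nonnegative derivative on [0, X], so the mean
    value theorem makes them nonnegative there. This replaces an integral form of the Taylor
    remainder. *)
Lemma le_norm_of_derive (R : realType) (f g df dg : R -> R) (X : R) :
  (forall y : R, 0 <= y -> is_derive y 1 f (df y)) ->
  (forall y : R, 0 <= y -> is_derive y 1 g (dg y)) ->
  f 0 = 0 -> g 0 = 0 ->
  (forall y : R, 0 <= y <= X -> `|df y| <= dg y) ->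
  forall x : R, 0 <= x <= X -> `|f x| <= g x.
Proof.
move=> fd gd f0 g0 dfg x /andP[x0 xX].
have cont (h dh : R -> R) : (forall y : R, 0 <= y -> is_derive y 1 h (dh y)) ->
    {within `[0, x], continuous (h : R -> R)}.
  move=> hd; apply: derivable_within_continuous => y.
  by rewrite in_itv/= => /andP[y0 _]; have := hd _ y0 => -[].
have key (h dh : R -> R) : (forall y : R, 0 <= y -> is_derive y 1 h (dh y)) -> h 0 = 0 ->
    (forall y : R, 0 <= y <= X -> 0 <= dh y) -> 0 <= h x.
  move=> hd h0 dh0; have [|||c] := @MVT_segment R h dh 0 x => //.
  - by move=> y; rewrite in_itv/= => /andP[/ltW y0 _]; apply: hd.
  - exact: (cont _ _ hd).
  - rewrite in_itv/= => /andP[c0 cx]; rewrite h0 !subr0 => ->.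
    by rewrite mulr_ge0// dh0// c0 (le_trans cx).
have h1 : 0 <= g x + f x.
  apply: (key (g + f) (fun y => dg y + df y)) => [y y0||y].
  - by apply: is_deriveD; [exact: gd|exact: fd].
  - rewrite [LHS]/(g 0 + f 0) g0 f0; exact: addr0.
  - by move=> /dfg; rewrite ler_norml; lra.
have h2 : 0 <= g x - f x.
  apply: (key (g - f) (fun y => dg y - df y)) => [y y0||y].
  - by apply: is_deriveB; [exact: gd|exact: fd].
  - rewrite [LHS]/(g 0 - f 0) g0 f0; exact: subr0.
  - by move=> /dfg; rewrite ler_norml; lra.
by rewrite ler_norml; lra.
Qed.

(** Taylor polynomial of (1 + x)^(- c) at 0, in the variable x itself; hence the signs, which
    disappear in the variable u = - x of [expands]. *)
Definition binomial_taylor (R : realType) (c : R) (K : nat) : {poly R} :=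
  \poly_(k < K) ((-1) ^+ k * pochhammer c k / k`!%:R).

Lemma deriv_binomial_taylor (R : realType) (c : R) K :
  (binomial_taylor c K.+1)^`() = - c *: binomial_taylor (c + 1) K.
Proof.
apply/polyP => k; rewrite coef_deriv coefZ !coef_poly ltnS.
case: ifP => _; last by rewrite mulr0 mul0rn.
rewrite pochhammerSl -mulr_natr factS natrM exprS.
have h1 : (1 + k%:R : R) != 0 by rewrite addrC natr1 pnatr_eq0.
have h2 : (k`!%:R : R) != 0 by rewrite pnatr_eq0 -lt0n fact_gt0.
by field; rewrite h1 h2.
Qed.

Lemma is_derive_powR_1D (R : realType) (c y : R) : 0 <= y ->
  is_derive y 1 (fun x : R => (1 + x) `^ c) (c * (1 + y) `^ (c - 1)).
Proof.
move=> y0.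
have h : is_derive y 1 (fun x : R => 1 + x) 1.
  rewrite (_ : (fun x : R => 1 + x) = shift (1 : R)); first exact: is_derive_shift.
  by apply/funext => x; rewrite /shift/= addrC.
have h2 := @is_derive1_powR R c (1 + y) (ltr_pwDl ltr01 y0).
have := @is_derive1_comp R (fun z => z `^ c) (fun x => 1 + x) y _ _ h2 h.
by rewrite mulr1.
Qed.

(* The hypothesis depends on [c] and [K] only through [c + K], so it survives the
   induction step, where differentiation replaces [(c, K.+1)] by [(c + 1, K)]. *)
Lemma binomial_taylor_bound (R : realType) K (c M X : R) :
  (forall x, 0 <= x <= X -> (1 + x) `^ (- c - K%:R) <= M) ->
  forall x, 0 <= x <= X ->
  `|(1 + x) `^ (- c) - (binomial_taylor c K).[x]| <=
  `|pochhammer c K| / K`!%:R * M * x ^+ K.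
Proof.
elim: K c => [|K IH] c bnd x xX.
  rewrite /binomial_taylor poly_def big_ord0 horner0 subr0 /pochhammer big_ord0.
  rewrite normr1 fact0 divr1 mul1r expr0 mulr1 ger0_norm ?powR_ge0//.
  by have := bnd _ xX; rewrite subr0.
have {}IH : forall x, 0 <= x <= X ->
    `|(1 + x) `^ (- c - 1) - (binomial_taylor (c + 1) K).[x]|
       <= `|pochhammer (c + 1) K| / K`!%:R * M * x ^+ K.
  move=> y yX; rewrite -opprD; apply: IH yX => z zX.
  by rewrite opprD -addrA -opprD nat1r; exact: bnd.
set C := `|pochhammer c K.+1| / K.+1`!%:R * M.
apply: (@le_norm_of_derive R
  (fun x => (1 + x) `^ (- c) - (binomial_taylor c K.+1).[x])
  (fun x => C * x ^+ K.+1)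
  (fun x => - c * ((1 + x) `^ (- c - 1) - (binomial_taylor (c + 1) K).[x]))
  (fun x => C * (K.+1%:R * x ^+ K)) X) => // [y y0|y y0|||y yX].
- rewrite mulrBr; apply: is_deriveB; first exact: is_derive_powR_1D.
  apply: (is_derive_eq (is_derive_poly (binomial_taylor c K.+1) y)).
  by rewrite deriv_binomial_taylor hornerZ.
- have -> : (fun x : R => C * x ^+ K.+1) = horner (C *: 'X^(K.+1)).
    by apply/funext => z; rewrite hornerZ hornerXn.
  apply: (is_derive_eq (is_derive_poly (C *: 'X^(K.+1)) y)).
  by rewrite derivZ derivXn hornerZ hornerMn hornerXn /= mulr_natl.
- rewrite addr0 powR1 horner_coef0 coef_poly /= expr0 /pochhammer big_ord0.
  by rewrite fact0 mul1r divr1 subrr.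
- by rewrite exprS mul0r mulr0.
- rewrite normrM normrN.
  have -> : C * (K.+1%:R * y ^+ K) =
     `|c| * (`|pochhammer (c + 1) K| / K`!%:R * M * y ^+ K).
    rewrite /C pochhammerSl normrM factS natrM.
    have h1 : (1 + K%:R : R) != 0 by rewrite addrC natr1 pnatr_eq0.
    have h2 : (K`!%:R : R) != 0 by rewrite pnatr_eq0 -lt0n fact_gt0.
    by field; rewrite h1 h2.
  by rewrite ler_wpM2l// IH.
Qed.

(** * Subexponential sequences and the binomial series *)

(** A growth class stable under products, so that summability against a geometric sequence needs no
    explicit constants. *)
Definition subexponential (R : realType) (s : R^nat) :=
  forall q : R, 1 < q -> exists C, forall m, `|s m| <= C * q ^+ m.

(** The ratio of consecutive terms is at most 1 + B / (m + 1), hence at most q once m reaches some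
    N. The sum of the terms up to N serves as the constant: it dominates each of them and the ratio
    bound takes over afterwards. *)
Lemma subexponential_ratio (R : realType) (s : R^nat) (B : R) :
  (forall m, 0 <= s m) ->
  (forall m, s m.+1 * m.+1%:R <= s m * (m.+1%:R + B)) ->
  subexponential s.
Proof.
move=> s0 sB q q1.
have [N BN] : exists N : nat, B <= (q - 1) * N%:R.
  exists (Num.truncn (B / (q - 1))).+1.
  rewrite mulrC -ler_pdivrMr ?subr_gt0//.
  by apply/ltW/truncnS_gt.
exists (\sum_(i < N.+1) s i) => m; rewrite ger0_norm//.
have q0 : 0 < q by rewrite (lt_trans _ q1).
have small i : (i <= N)%N -> s i <= (\sum_(i < N.+1) s i) * q ^+ i.
  rewrite -ltnS => iN; rewrite (bigD1 (Ordinal iN))//= mulrDl.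
  rewrite -[leLHS]addr0 lerD//.
    by rewrite ler_peMr// exprn_ege1// ltW.
  by rewrite mulr_ge0 ?exprn_ge0 ?sumr_ge0// ltW.
elim: m => [|m IH]; first exact: small.
have [mN|Nm] := leqP m.+1 N; first exact: small.
rewrite exprSr mulrA -(ler_pM2r (ltr0Sn R m)).
apply: (le_trans (sB m)).
have h : m.+1%:R + B <= q * m.+1%:R.
  rewrite -lerBrDl -[X in _ - X]mul1r -mulrBl (le_trans BN)//.
  by rewrite ler_wpM2l ?subr_ge0 ?ler_nat; [|exact: ltW|exact: ltnW].
apply: (le_trans (ler_wpM2l (s0 m) h)).
by rewrite -(mulrA (_ * _)) ler_wpM2r// mulr_ge0// ltW.
Qed.

Lemma subexponential_le (R : realType) (s t : R^nat) :
  subexponential t -> (forall m, `|s m| <= t m) -> subexponential s.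
Proof.
move=> tse st q /tse[C tC]; exists C => m.
by rewrite (le_trans (st m))// (le_trans (ler_norm _)).
Qed.

Lemma subexponentialM (R : realType) (s t : R^nat) :
  subexponential s -> subexponential t -> subexponential (fun m => s m * t m).
Proof.
move=> sse tse q q1.
(* Each factor is allowed growth at rate [Num.sqrt q], so the product grows at rate [q]. *)
have r1 : 1 < Num.sqrt q by rewrite -sqrtr1 ltr_sqrt// (lt_trans _ q1).
have [[C sC] [D tD]] := (sse _ r1, tse _ r1).
exists (C * D) => m; rewrite normrM.
have -> : C * D * q ^+ m = (C * Num.sqrt q ^+ m) * (D * Num.sqrt q ^+ m).
  rewrite mulrACA -exprD addnn -muln2 mulnC exprM sqr_sqrtr//.
  by rewrite ltW// (lt_trans _ q1).
exact: ler_pM.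
Qed.

Lemma subexponential_linear (R : realType) (c : R) : 1 <= c ->
  subexponential (fun m => m%:R + c).
Proof.
move=> c1; apply: (@subexponential_ratio _ _ 1) => m.
  by rewrite addr_ge0// (le_trans _ c1).
have m0 : (0 : R) <= m%:R by [].
by rewrite -natr1; nra.
Qed.

Lemma subexponential_pochhammer_fact (R : realType) (mu : R) : 0 <= mu ->
  subexponential (fun m => pochhammer mu m / m`!%:R).
Proof.
move=> mu0; apply: (@subexponential_ratio _ _ mu) => m.
  by rewrite divr_ge0// pochhammer_ge0.
have -> : pochhammer mu m.+1 / m.+1`!%:R * m.+1%:R =
    pochhammer mu m / m`!%:R * (mu + m%:R).
  rewrite pochhammerS factS natrM.
  have h1 : (1 + m%:R : R) != 0 by rewrite addrC natr1 pnatr_eq0.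
  have h2 : (m`!%:R : R) != 0 by rewrite pnatr_eq0 -lt0n fact_gt0.
  by field; rewrite h1 h2.
rewrite ler_wpM2l//; first by rewrite divr_ge0// pochhammer_ge0.
by rewrite addrC lerD// ler_nat.
Qed.

Lemma subexponential_pochhammer (R : realType) (c : R^nat) (b : R) k :
  1 <= b -> (forall m, `|c m| <= m%:R + b) ->
  subexponential (fun m => pochhammer (c m) k).
Proof.
move=> b1 cb; elim: k => [|k IH].
  apply: (subexponential_le (subexponential_linear b1)) => m.
  by rewrite /pochhammer big_ord0 normr1 (le_trans b1)// lerDr.
have -> : (fun m => pochhammer (c m) k.+1) =
    (fun m => pochhammer (c m) k * (c m + k%:R)).
  by apply/funext => m; rewrite pochhammerS.
apply: subexponentialM => //.
apply: (@subexponential_le _ _ (fun m => m%:R + (b + k%:R))).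
  by apply: subexponential_linear; rewrite (le_trans b1)// lerDl.
by move=> m; rewrite addrA (le_trans (ler_normD _ _))// normr_nat lerD2r.
Qed.

Lemma subexponential_summable (R : realType) (s : R^nat) (rho : R) :
  0 <= rho < 1 -> subexponential s ->
  cvgn (series (fun m => `|s m| * rho ^+ m)).
Proof.
move=> /andP[rho0 rho1] sse.
(* The rate 2 / (1 + rho) exceeds 1, yet its product with [rho] stays below 1, which leaves a
   convergent geometric majorant. *)
have q1 : 1 < 2 / (1 + rho) by rewrite ltr_pdivlMr; lra.
have [C sC] := sse _ q1.
have C0 : 0 <= C by have := sC 0%N; rewrite expr0 mulr1; exact: le_trans.
have q0 : 0 <= 2 / (1 + rho) * rho by rewrite mulr_ge0// divr_ge0// addr_ge0.
have ql : 2 / (1 + rho) * rho < 1.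
  by rewrite mulrAC ltr_pdivrMr; lra.
apply: (@series_le_cvg _ _ (geometric C (2 / (1 + rho) * rho))) => [m|m|m|].
- by rewrite mulr_ge0// exprn_ge0.
- exact: geometric_ge0.
- by rewrite /= exprMn mulrA ler_wpM2r ?exprn_ge0.
- by apply: is_cvg_geometric_series; rewrite ger0_norm.
Qed.

(** The Taylor remainder is at most the first omitted term (with M = 1, the exponent - mu - K being
    nonpositive), and that term tends to 0 as the general term of a convergent series. *)
Lemma cvg_binomial_series (R : realType) (mu y : R) : 0 <= mu -> 0 <= y < 1 ->
  series (fun m => (-1) ^+ m * pochhammer mu m / m`!%:R * y ^+ m) @ \oo
    --> (1 + y) `^ (- mu).
Proof.
move=> mu0 /andP[y0 y1].
have bnd K : `|(1 + y) `^ (- mu) -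
     series (fun m => (-1) ^+ m * pochhammer mu m / m`!%:R * y ^+ m) K| <=
   `|pochhammer mu K / K`!%:R| * y ^+ K.
  have -> : series (fun m => (-1) ^+ m * pochhammer mu m / m`!%:R * y ^+ m) K =
      (binomial_taylor mu K).[y].
    by rewrite /series/= big_mkord horner_poly.
  have := @binomial_taylor_bound R K mu 1 y _ y.
  rewrite y0 lexx mulr1 normrM normfV normr_nat.
  apply => // x /andP[x0 _]; rewrite -opprD -[leRHS](powRr0 (1 + x)).
  by apply: ler_powR; rewrite ?lerDl// oppr_le0 addr_ge0.
have y01 : 0 <= y < 1 by rewrite y0.
have := cvg_series_cvg_0 (subexponential_summable y01
  (subexponential_pochhammer_fact mu0)).
move=> /cvgrPdist_le h; apply/cvgrPdist_le => e /h.
apply: filterS => K; apply: le_trans; rewrite sub0r normrN.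
by apply: (le_trans (bnd K)); rewrite ler_norm.
Qed.

(** * One-sided polynomial expansions modulo a power of x *)

Lemma horner_bounded01 (R : realType) (p : {poly R}) :
  exists2 B, 0 <= B & forall x, 0 <= x <= 1 -> `|p.[- x]| <= B.
Proof.
exists (\sum_(i < size p) `|p`_i|); first exact: sumr_ge0.
move=> x /andP[x0 x1]; rewrite horner_coef (le_trans (ler_norm_sum _ _ _))//.
apply: ler_sum => i _; rewrite normrM normrX normrN (ger0_norm x0).
by rewrite ler_piMr// exprn_ile1.
Qed.

(* [p] is the expansion of [f] in the variable [u = - x] of the generating
   functions, one-sided and modulo [u ^+ K]. *)
Definition expands (R : realType) (f : R -> R) (p : {poly R}) (K : nat) :=
  exists C X : R, 0 < X /\
    forall x, 0 <= x <= X -> `|f x - p.[- x]| <= C * x ^+ K.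

Lemma expandsM (R : realType) (f g : R -> R) (p q : {poly R}) K :
  expands f p K -> expands g q K -> expands (fun x => f x * g x) (p * q) K.
Proof.
move=> [C [X [X0 fp]]] [D [Y [Y0 gq]]].
have [A A0 pA] := horner_bounded01 p; have [B B0 qB] := horner_bounded01 q.
exists (`|C| * (B + `|D|) + A * `|D|), (Num.min (Num.min X Y) 1); split.
  by rewrite !lt_min X0 Y0 ltr01.
move=> x; rewrite !le_min => /andP[x0 /andP[/andP[xX xY] x1]].
rewrite hornerM.
have -> : f x * g x - p.[-x] * q.[-x] =
    (f x - p.[-x]) * (q.[-x] + (g x - q.[-x])) + p.[-x] * (g x - q.[-x]) by ring.
have xK0 : 0 <= x ^+ K by rewrite exprn_ge0.
have xK1 : x ^+ K <= 1 by rewrite exprn_ile1.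
have hf : `|f x - p.[-x]| <= `|C| * x ^+ K.
  by rewrite (le_trans (fp _ _)) ?x0// ler_wpM2r// ler_norm.
have hg : `|g x - q.[-x]| <= `|D| * x ^+ K.
  by rewrite (le_trans (gq _ _)) ?x0// ler_wpM2r// ler_norm.
have hp : `|p.[-x]| <= A by apply: pA; rewrite x0.
have hq : `|q.[-x]| <= B by apply: qB; rewrite x0.
rewrite [leRHS]mulrDl (le_trans (ler_normD _ _))// !normrM lerD//.
  rewrite mulrAC; apply: ler_pM => //.
  rewrite (le_trans (ler_normD _ _))// lerD// (le_trans hg)//.
  by rewrite ler_piMr.
by rewrite -mulrA; apply: ler_pM.
Qed.

Lemma expands1 (R : realType) K : expands (fun=> 1 : R) 1 K.
Proof.
exists 0, 1; split => // x _.
by rewrite hornerC subrr normr0 mul0r.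
Qed.

Lemma expandsXn (R : realType) (f : R -> R) (p : {poly R}) K n :
  expands f p K -> expands (fun x => f x ^+ n) (p ^+ n) K.
Proof.
move=> fp; elim: n => [|n IH]; first exact: expands1.
rewrite exprS (_ : (fun x => f x ^+ n.+1) = fun x => f x * f x ^+ n).
  exact: expandsM.
by apply/funext => x; rewrite exprS.
Qed.

(** Letting x be small forces the constant term to vanish; dividing by x then lowers K by one. The
    bound is assumed for positive x only, since the division loses x = 0. *)
Lemma coef_eq0_of_bound (R : realType) K (s : {poly R}) (C X : R) : 0 < X ->
  (forall x, 0 < x <= X -> `|s.[- x]| <= C * x ^+ K) ->
  forall k, (k < K)%N -> s`_k = 0.
Proof.
move=> X0; elim: K s => [//|K IH] s.
elim/poly_ind: s => [|u c _]; first by move=> _ k _; rewrite coef0.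
move=> h.
have [B B0 uB] := horner_bounded01 u.
have c0 : c = 0.
  apply/eqP; rewrite -normr_le0 leNgt; apply/negP => c0.
  have BC : 0 < B + `|C| + 1 by rewrite ltr_wpDl// addr_ge0.
  (* At this x, (B + |C|) x is at most |c| / 2, while the hypothesis at x will give |c| <= (B + |C|)
     x. *)
  set x := Num.min (Num.min X 1) (`|c| / (B + `|C| + 1) / 2).
  have x0 : 0 < x by rewrite /x !lt_min X0 ltr01/= !divr_gt0.
  have xX : x <= X by rewrite /x !ge_min lexx.
  have x1 : x <= 1 by rewrite /x !ge_min lexx orbT.
  have xc : x <= `|c| / (B + `|C| + 1) / 2 by rewrite /x !ge_min lexx !orbT.
  have := h x; rewrite x0 xX => /(_ isT); rewrite !hornerE => hx.
  have := uB x; rewrite (ltW x0) x1 => /(_ isT) ux.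
  have h1 : `|c| <= (B + `|C|) * x.
    have -> : c = (u.[-x] * - x + c) + u.[-x] * x by ring.
    rewrite (le_trans (ler_normD _ _))// [leRHS]mulrDl addrC lerD//.
      by rewrite normrM (gtr0_norm x0) ler_wpM2r// ltW.
    rewrite (le_trans hx)// (le_trans (ler_norm _))// normrM ler_wpM2l//.
    rewrite normrX (gtr0_norm x0) exprS ler_piMr// ?exprn_ile1// ltW//.
  move: xc; rewrite -mulrA -invfM ler_pdivlMr ?mulr_gt0//.
  by move: h1; nra.
move=> [|k]; rewrite coefD coefMX coefC /= ?add0r// addr0.
rewrite ltnS => kK; apply: IH kK => x xX.
have /andP[x0 _] := xX.
have := h x xX; rewrite c0 !hornerE ?addr0 normrM normrN (gtr0_norm x0).
by rewrite exprSr mulrA ler_pM2r.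
Qed.

Lemma expands_uniq (R : realType) (f : R -> R) (p q : {poly R}) K :
  expands f p K -> expands f q K -> forall k, (k < K)%N -> p`_k = q`_k.
Proof.
move=> [C [X [X0 fp]]] [D [Y [Y0 fq]]] k kK.
apply/eqP; rewrite -subr_eq0 -coefB; apply/eqP.
apply: (@coef_eq0_of_bound _ K _ (C + D) (Num.min X Y)) kK.
  by rewrite lt_min X0 Y0.
move=> x; rewrite le_min => /and3P[/ltW x0 xX xY].
have := fp x; rewrite x0 xX => /(_ isT) h1.
have := fq x; rewrite x0 xY => /(_ isT) h2.
rewrite hornerD hornerN mulrDl.
have -> : p.[-x] - q.[-x] = (f x - q.[-x]) - (f x - p.[-x]) by ring.
by rewrite (le_trans (ler_normB _ _))// addrC lerD.
Qed.

(** For a partial sum over m, the exchange with the Taylor sum over k is finite, and the remainders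
    add up to a bound independent of N. The bound then passes to the limit for each fixed x. *)
Lemma expands_binomial_sum (R : realType) (a c M : R^nat) K (X : R)
    (f : R -> R) :
  0 < X ->
  (forall m x, 0 <= x <= X -> (1 + x) `^ (- c m - K%:R) <= M m) ->
  (forall k, (k < K)%N -> cvgn (series (fun m => a m * pochhammer (c m) k))) ->
  cvgn (series (fun m => `|a m| * (`|pochhammer (c m) K| * M m))) ->
  (forall x, 0 <= x <= X ->
     series (fun m => a m * (1 + x) `^ (- c m)) @ \oo --> f x) ->
  expands f (\poly_(k < K)
    (limn (series (fun m => a m * pochhammer (c m) k)) / k`!%:R)) K.
Proof.
move=> X0 bnd cpoch csum cf.
set S := series (fun m => `|a m| * (`|pochhammer (c m) K| * M m)) in csum.
have M0 m : 0 <= M m.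
  by apply: le_trans (bnd m 0 _); rewrite ?powR_ge0// lexx ltW.
have SN N : S N <= limn S.
  apply: nondecreasing_cvgn_le => //; apply: nondecreasing_series => i _ _.
  by rewrite !mulr_ge0.
exists (limn S / K`!%:R), X; split=> // x xX.
have /andP[x0 _] := xX.
pose T N := series (fun m => a m * (1 + x) `^ (- c m)) N -
  \sum_(k < K) (series (fun m => a m * pochhammer (c m) k) N / k`!%:R * (- x) ^+ k).
have cT : T @ \oo --> f x - (\poly_(k < K)
    (limn (series (fun m => a m * pochhammer (c m) k)) / k`!%:R)).[- x].
  apply: cvgB; first exact: cf.
  rewrite horner_poly; apply: cvg_big => //[|k _]; first exact: add_continuous.
  by apply: cvgMr_tmp; apply: cvgMr_tmp; apply: cpoch.
have Tb N : `|T N| <= limn S / K`!%:R * x ^+ K.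
  have -> : T N = \sum_(0 <= m < N)
      a m * ((1 + x) `^ (- c m) - (binomial_taylor (c m) K).[x]).
    rewrite /T /series/=.
    rewrite [X in _ - X](eq_bigr (fun k : 'I_K => \sum_(0 <= m < N)
      a m * pochhammer (c m) k / k`!%:R * (- x) ^+ k)); last first.
      by move=> k _; rewrite -!mulr_suml.
    rewrite exchange_big/= -sumrB; apply: eq_bigr => m _.
    rewrite mulrBr /binomial_taylor horner_poly mulr_sumr; congr (_ - _).
    by apply: eq_bigr => k _; rewrite (exprNn x); ring.
  rewrite (le_trans (ler_norm_sum _ _ _))//.
  apply: (@le_trans _ _ (S N / K`!%:R * x ^+ K)); last first.
    by rewrite ler_wpM2r ?exprn_ge0// ler_wpM2r.
  rewrite /S /series/= mulr_suml mulr_suml; apply: ler_sum => m _.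
  rewrite normrM -!mulrA ler_wpM2l//.
  apply: (le_trans (@binomial_taylor_bound R K (c m) (M m) X (bnd m) x xX)).
  by rewrite le_eqVlt; apply/orP; left; apply/eqP; ring.
apply: (cvgr_to_le (cvg_norm cT)).
exact: nearW.
Qed.

(** * Functional equation and positivity of the Gamma integral on [1, +oo[ *)

Section Gamma_function.
Variable R : realType.
Implicit Types (c r s x : R).
Local Notation mu := (@lebesgue_measure R).
Local Notation D := (`[0, +oo[%classic : set R).

Let mD : measurable (D : set (measurableTypeR R)). Proof. exact: measurable_itv. Qed.

Lemma is_derive_expRM r x :
  is_derive x 1 (fun s : R => expR (r * s)) (r * expR (r * x)).
Proof.
have h : is_derive x 1 (fun s : R => r * s) r.
  have := is_deriveZ r (is_derive_id x (1 : R)).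
  by rewrite /GRing.scale/= mulr1.
have := @is_derive1_comp R expR (fun s => r * s) x _ _ (is_derive_expR _) h.
by rewrite mulrC.
Qed.

Lemma continuous_expRM r : continuous (fun s : R => expR (r * s)).
Proof.
move=> x; apply: differentiable_continuous; apply/derivable1_diffP.
by have [] := is_derive_expRM r x.
Qed.

Lemma cvg_expRM r : r < 0 -> expR (r * s) @[s --> +oo] --> (0 : R).
Proof.
move=> r0; rewrite (_ : (fun s => expR (r * s)) =
    (fun z => expR (- z)) \o (fun z => - r * z)); last first.
  by apply/funext => s /=; rewrite mulNr opprK.
apply: (@cvg_comp _ _ _ _ _ _ (pinfty_nbhs R)); last exact: cvgr_expR.
by apply: gt0_cvgMry => //; rewrite oppr_gt0.
Qed.

(** For c > 0, raise s / (2c) <= exp(s / (2c)) to the power c. The majorant exp(- s / 2) has an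
    explicit primitive, which gives integrability. *)
Lemma powR_expR_le c s : 0 <= c -> 0 <= s ->
  s `^ c * expR (- s) <= (2 * c) `^ c * expR (- 2^-1 * s).
Proof.
move=> c0 s0.
have -> : expR (- 2^-1 * s) = expR (2^-1 * s) * expR (- s).
  by rewrite -expRD; congr expR; lra.
rewrite mulrA ler_wpM2r ?expR_ge0//.
move: c0; rewrite le_eqVlt => /predU1P[<-|c0].
  by rewrite !powRr0 mul1r -expR0 ler_expR mulr_ge0.
have h : s <= 2 * c * expR (s / (2 * c)).
  have c2 : 0 < 2 * c by rewrite mulr_gt0.
  by rewrite -ler_pdivrMl// mulrC (le_trans _ (expR_ge1Dx _))// lerDr.
have -> : expR (2^-1 * s) = expR (s / (2 * c)) `^ c.
  rewrite /powR gt_eqF ?expR_gt0// expRK; congr expR.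
  by field; rewrite gt_eqF.
rewrite -powRM ?expR_ge0 ?mulr_ge0 ?(ltW c0)//.
by rewrite ge0_ler_powR ?nnegrE ?mulr_ge0 ?expR_ge0 ?(ltW c0)//.
Qed.

Lemma continuous_powR_expR c : 0 <= c ->
  {within D, continuous (fun s : R => s `^ c * expR (- s))}.
Proof.
move=> c0; have cE : continuous (fun s : R => expR (- s)).
  rewrite (_ : (fun s => _) = fun s => expR (-1 * s)).
    exact: continuous_expRM.
  by apply/funext => s; rewrite mulN1r.
apply/continuous_within_itvcyP; split.
  move=> x; rewrite in_itv/= andbT => x0.
  apply: cvgM; last exact: cE.
  have h : derivable (fun s : R => s `^ c) x 1.
    by apply: derivable_powR; rewrite in_itv/= andbT.
  by move/derivable1_diffP/differentiable_continuous : h.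
apply: cvgM; last by apply: cvg_at_right_filter; exact: cE.
(* The value of the power at 0 is 1 if c = 0 and 0 if c > 0; it is the right limit in both cases. *)
move: c0; rewrite le_eqVlt => /predU1P[<-|c0].
  rewrite powRr0 (_ : (fun x => _) = fun=> 1); first exact: cvg_cst.
  by apply/funext => x; rewrite powRr0.
by rewrite powR0 ?gt_eqF//; exact: powR_cvg0.
Qed.

Lemma integral_expRM : (\int[mu]_(s in D) (expR (- 2^-1 * s))%:E = 2%:E)%E.
Proof.
rewrite (@ge0_continuous_FTC2y R _ (fun s => - 2 * expR (- 2^-1 * s)) 0 0).
- by rewrite mulr0 expR0 mulr1 -EFinD opprK add0r.
- by move=> x _; exact: expR_ge0.
- exact/continuous_subspaceT/continuous_expRM.
- rewrite -[X in _ --> X](mulr0 (- 2)); apply: cvgM; first exact: cvg_cst.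
  by apply: cvg_expRM; rewrite oppr_lt0.
- by move=> x _; apply: derivableM.
- apply: cvg_at_right_filter; apply: cvgM; first exact: cvg_cst.
  exact: continuous_expRM.
- move=> x _; rewrite derive1E.
  have h := is_derive_expRM (- 2^-1) x.
  have h2 : is_derive x 1 (fun s : R => - 2 * expR (- 2^-1 * s))
     (- 2 * (- 2^-1 * expR (- 2^-1 * x))) by exact: (is_deriveZ (-2) h).
  by rewrite derive_val; field.
Qed.

Lemma integrable_expRM : mu.-integrable D (EFin \o (fun s => expR (- 2^-1 * s))).
Proof.
apply/integrableP; split.
  apply/measurable_EFinP/measurable_funTS; apply: continuous_measurable_fun.
  exact: continuous_expRM.
under eq_integral do rewrite /= ger0_norm ?expR_ge0//.
by rewrite integral_expRM ltry.
Qed.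

Lemma integrable_powR_expR c : 0 <= c ->
  mu.-integrable D (EFin \o (fun s => s `^ c * expR (- s))).
Proof.
move=> c0.
apply: (@le_integrable _ _ _ _ _ mD _
  (EFin \o (fun s => (2 * c) `^ c * expR (- 2^-1 * s)))) => //.
- apply/measurable_EFinP.
  by apply: subspace_continuous_measurable_fun => //; exact: continuous_powR_expR.
- move=> x; rewrite /D/= in_itv/= andbT => x0; rewrite lee_fin.
  rewrite !ger0_norm ?mulr_ge0 ?powR_ge0 ?expR_ge0//.
  exact: powR_expR_le.
- have := integrableZl mD ((2 * c) `^ c) integrable_expRM.
  by apply: eq_integrable => // x _; rewrite /= EFinM.
Qed.

(** The endpoint 0 is a null set; adding it gives the closed half-line on which the fundamental
    theorem is applied. *)
Lemma GammaE c : 1 <= c -> Gamma c = \int[mu]_(s in D) (s `^ (c - 1) * expR (- s)).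
Proof.
move=> c1; apply: Rintegral_itv_obnd_cbnd.
apply: integrableS (@integrable_powR_expR (c - 1) _) => //; last first.
  by rewrite subr_ge0.
by apply: subset_itvr; rewrite bnd_simp.
Qed.

Lemma is_derive_gamma_primitive c r x : 0 < x ->
  is_derive x 1 (fun s : R => s `^ c * expR (- s) - r * 2 * expR (- 2^-1 * s))
    (c * (x `^ (c - 1) * expR (- x)) +
      (r * expR (- 2^-1 * x) - x `^ c * expR (- x))).
Proof.
move=> x0.
have h := is_deriveB (is_deriveM (is_derive1_powR c x0) (is_derive_expRM (-1) x))
  (is_deriveZ (r * 2) (is_derive_expRM (- 2^-1) x)).
rewrite (_ : (fun s : R => s `^ c * expR (- s) - r * 2 * expR (- 2^-1 * s)) =
  ((fun s : R => s `^ c) * (fun s : R => expR (-1 * s)) -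
     (r * 2) \*: (fun s : R => expR (- 2^-1 * s)) : R -> R)); last first.
  by apply/funext => s; rewrite !fctE mulN1r.
apply: is_derive_eq h _.
by rewrite /GRing.scale/= (mulN1r x); field.
Qed.

(* The derivative of [s `^ c * expR (- s)] changes sign at [s = c]; subtracting a
   multiple of [expR (- s / 2)] makes it nonnegative, as the fundamental theorem
   on a half-line requires. *)
Lemma GammaS c : 1 <= c -> Gamma (c + 1) = c * Gamma c.
Proof.
move=> c1.
have c0 : 0 < c by rewrite (lt_le_trans _ c1).
have c10 : 0 <= c - 1 by rewrite subr_ge0.
rewrite !GammaE ?lerDr//; last exact: ltW.
rewrite addrK.
pose B := (2 * c) `^ c.
pose f s := c * (s `^ (c - 1) * expR (- s)) + (B * expR (- 2^-1 * s) - s `^ c * expR (- s)).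
have i1 := integrable_powR_expR c10.
have i2 := integrable_powR_expR (ltW c0).
have i1c : mu.-integrable D (EFin \o (fun s => c * (s `^ (c - 1) * expR (- s)))).
  have := integrableZl mD c i1.
  by apply: eq_integrable => // x _; rewrite /= EFinM.
have i3 : mu.-integrable D (EFin \o (fun s => B * expR (- 2^-1 * s))).
  have := integrableZl mD B integrable_expRM.
  by apply: eq_integrable => // x _; rewrite /= EFinM.
have i32 : mu.-integrable D
    (EFin \o (fun s => B * expR (- 2^-1 * s) - s `^ c * expR (- s))).
  have := integrableB mD i3 i2.
  by apply: eq_integrable => // x _; rewrite /= EFinB.
have e1 : \int[mu]_(s in D) f s =
    c * \int[mu]_(s in D) (s `^ (c - 1) * expR (- s)) +
    (B * 2 - \int[mu]_(s in D) (s `^ c * expR (- s))).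
  rewrite RintegralD// RintegralB// !RintegralZl//; last exact: integrable_expRM.
  by rewrite [X in B * X]/Rintegral integral_expRM.
(* The primitive below equals - 2B at 0 and tends to 0 at infinity. Comparison with [e1] cancels 2B
   and leaves the recurrence. *)
suff e2 : \int[mu]_(s in D) f s = B * 2.
  move: e1; rewrite e2 addrCA -[X in X = _]addr0 => /addrI/esym/eqP.
  by rewrite subr_eq0 => /eqP/esym.
rewrite (@Rintegral_ge0_continuous_FTC2y R f
  (fun s => s `^ c * expR (- s) - B * 2 * expR (- 2^-1 * s)) 0 0).
- by rewrite powR0 ?gt_eqF// mul0r mulr0 expR0 mulr1 !sub0r opprK.
- move=> x x0; rewrite /f addr_ge0//.
    by rewrite !mulr_ge0 ?powR_ge0 ?expR_ge0// (ltW c0).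
  by rewrite subr_ge0; apply: powR_expR_le => //; exact: ltW.
- move=> x; apply: cvgD.
    by apply: cvgM; [exact: cvg_cst|exact: continuous_powR_expR].
  apply: cvgB; last by apply: continuous_powR_expR; exact: ltW.
  apply: cvgM; first exact: cvg_cst.
  by apply: continuous_subspaceT; exact: continuous_expRM.
- rewrite -[X in _ --> X](subrr 0); apply: cvgB; last first.
    rewrite -[X in _ --> X](mulr0 (B * 2)); apply: cvgM; first exact: cvg_cst.
    by apply: cvg_expRM; rewrite oppr_lt0.
  have h0 : B * expR (- 2^-1 * s) @[s --> +oo] --> (0 : R).
    rewrite -[X in _ --> X](mulr0 B); apply: cvgM; first exact: cvg_cst.
    by apply: cvg_expRM; rewrite oppr_lt0.
  apply: (squeeze_cvgr _ (cvg_cst 0) h0).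
  near=> s; rewrite mulr_ge0 ?powR_ge0 ?expR_ge0//=.
  by apply: powR_expR_le; [exact: ltW|near: s; exact: nbhs_pinfty_ge].
- move=> x x0; apply: derivableB; apply: derivableM => //.
  by apply: derivable_powR; rewrite in_itv/= andbT.
- have : {within D, continuous (fun s => s `^ c * expR (- s) - B * 2 * expR (- 2^-1 * s))}.
    move=> x; apply: cvgB; first by apply: continuous_powR_expR; exact: ltW.
    apply: cvgM; first exact: cvg_cst.
    by apply: continuous_subspaceT; exact: continuous_expRM.
  by move/continuous_within_itvcyP => [].
- move=> x; rewrite in_itv/= andbT => x0; rewrite derive1E.
  have h := is_derive_gamma_primitive c B x0.
  by rewrite derive_val.
Unshelve. all: by end_near. Qed.

Local Notation I := (`[1, 2]%classic : set R).

(** On [1, 2] the integrand is at least exp(- 2), and this interval has length 1. *)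
Lemma Gamma_gt0 c : 1 <= c -> 0 < Gamma c.
Proof.
move=> c1; rewrite GammaE//.
have c10 : 0 <= c - 1 by rewrite subr_ge0.
have i1 := integrable_powR_expR c10.
have sub : I `<=` D by apply: subset_itv; rewrite bnd_simp.
have mu12 : mu I = 1%:E.
  have := @lebesgue_measure_itv R `[1, 2]; rewrite /= lte_fin ltr1n -EFinB => ->.
  by congr EFin; lra.
apply: (@lt_le_trans _ _ (expR (- 2))); first exact: expR_gt0.
have i2 : mu.-integrable I (EFin \o (fun s => s `^ (c - 1) * expR (- s))).
  exact: integrableS i1.
apply: (@le_trans _ _ (\int[mu]_(s in I) (s `^ (c - 1) * expR (- s)))).
  have <- : \int[mu]_(s in I) expR (- 2) = expR (- 2).
    transitivity (expR (- 2) * fine (mu I)); last by rewrite mu12 mulr1.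
    exact: Rintegral_cst.
  apply: le_Rintegral => //.
    apply: measurable_bounded_integrable => //.
    + by have mu12y : (mu I < +oo)%E by rewrite mu12 ltry.
    + exact: bounded_cst.
  move=> x /=; rewrite in_itv/= => /andP[x1 x2].
  rewrite -[leLHS]mul1r ler_pM ?expR_ge0// ?ler_expR ?lerN2//.
  by rewrite -[leLHS](powRr0 x); apply: ler_powR.
rewrite /Rintegral fine_le//.
- exact: integrable_fin_num.
- exact: integrable_fin_num.
- apply: ge0_subset_integral => //; first by case/integrableP : i1.
  by move=> x _; rewrite lee_fin mulr_ge0 ?powR_ge0 ?expR_ge0.
Qed.

Lemma Gamma_ratio c k : 1 <= c -> Gamma (c + k%:R) / Gamma c = pochhammer c k.
Proof.
move=> c1; elim: k => [|k IH].
  by rewrite addr0 divff ?gt_eqF ?Gamma_gt0// /pochhammer big_ord0.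
have ck : 1 <= c + k%:R by rewrite (le_trans c1)// lerDl.
by rewrite -natr1 addrA GammaS// -mulrA IH mulrC pochhammerS.
Qed.

End Gamma_function.

(** * Mixtures of powers of 1 + x and the coefficients [calP] *)

Lemma eq_expands (R : realType) (f g : R -> R) (p : {poly R}) K :
  (forall x, 0 <= x -> f x = g x) -> expands f p K -> expands g p K.
Proof.
move=> fg [C [X [X0 fp]]]; exists C, X; split=> // x xX.
by rewrite -fg; [exact: fp|case/andP: xX].
Qed.

Lemma expandsC (R : realType) (a : R) K : expands (fun=> a) a%:P K.
Proof.
exists 0, 1; split => // x _.
by rewrite hornerC subrr normr0 mul0r.
Qed.

Section binomial_mixture.
Variables (R : realType) (mu rho e theta : R).
Hypotheses (mu0 : 0 <= mu) (rho01 : 0 < rho < 1) (e0 : 0 <= e)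
  (theta1 : `|theta| <= 1).

(** Weights of the powers (1 + x)^(- c_m), coming from the binomial series of (1 + rho y)^(- mu).
    The section is used with [rho] = xi, [theta] = alpha if xi < 1, and with [rho] = 1 / xi, [theta]
    = - alpha if xi > 1. *)
Definition mixture_coef (m : nat) : R :=
  (-1) ^+ m * pochhammer mu m / m`!%:R * rho ^+ m.

Let c (m : nat) : R := e + theta * m%:R.

(** The weights are subexponential times rho^m, and [pochhammer (c m) k] has polynomial growth in m.
    The factor q^m makes room for the Taylor remainders; q = 1 gives the coefficient series
    themselves. *)
Lemma summable_mixture k (q : R) : 0 <= q -> rho * q < 1 ->
  cvgn (series (fun m => `|mixture_coef m| * (`|pochhammer (c m) k| * q ^+ m))).
Proof.
move=> q0 rq1; have /andP[rho0 _] := rho01.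
have rq : 0 <= rho * q < 1 by rewrite mulr_ge0// ltW.
have cb m : `|c m| <= m%:R + (1 + e).
  rewrite (le_trans (ler_normD _ _))// normrM normr_nat (ger0_norm e0).
  rewrite addrC addrA lerD2r (@le_trans _ _ m%:R) ?lerDl//.
  by rewrite ler_piMl.
have e1 : 1 <= 1 + e by rewrite lerDl.
rewrite (_ : (fun m => _) = fun m =>
    `|pochhammer mu m / m`!%:R * pochhammer (c m) k| * (rho * q) ^+ m).
  exact: (subexponential_summable rq (subexponentialM
    (subexponential_pochhammer_fact mu0) (subexponential_pochhammer k e1 cb))).
apply/funext => m.
rewrite /mixture_coef !normrM normrX normrN1 expr1n mul1r exprMn.
by rewrite (ger0_norm (exprn_ge0 _ (ltW rho0))); ring.
Qed.

Lemma cvg_mixture k : cvgn (series (fun m => mixture_coef m * pochhammer (c m) k)).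
Proof.
have r1 : rho * 1 < 1 by rewrite mulr1; case/andP: rho01.
apply: normed_cvg.
rewrite (_ : [normed series _] = series
  (fun m => `|mixture_coef m| * (`|pochhammer (c m) k| * 1 ^+ m))).
  by apply: summable_mixture.
apply/funext => N; apply: eq_bigr => m _.
by rewrite expr1n mulr1 -normrM.
Qed.

Lemma expands_mixture K :
  expands (fun x => (1 + x) `^ (- e) * (1 + rho * (1 + x) `^ (- theta)) `^ (- mu))
    (\poly_(k < K)
      (limn (series (fun m => mixture_coef m * pochhammer (c m) k)) / k`!%:R)) K.
Proof.
have /andP[rho0 rho1] := rho01.
(* Chosen so that rho (1 + X) = 2 rho / (1 + rho) < 1. This keeps the argument of the binomial
   series below 1 and makes the remainders, of size (1 + X)^m, summable. *)
pose X := (1 - rho) / (1 + rho).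
have X0 : 0 < X by rewrite divr_gt0 ?subr_gt0// addr_gt0.
have rX : rho * (1 + X) < 1.
  rewrite (_ : _ * _ = rho * 2 / (1 + rho)); last first.
    by rewrite /X; field; rewrite gt_eqF// addr_gt0.
  by rewrite ltr_pdivrMr ?addr_gt0// mul1r; lra.
have h1 (x : R) : 0 <= x -> 1 <= 1 + x by rewrite lerDl.
have /andP[tl tr] : -1 <= theta <= 1 by rewrite -ler_norml.
apply: (@expands_binomial_sum _ mixture_coef c (fun m => (1 + X) ^+ m) _ X) => //.
(* Since e >= 0 and |theta| <= 1, the exponent - c_m - K is at most m. *)
- move=> m x /andP[x0 xX].
  apply: (@le_trans _ _ ((1 + x) ^+ m)).
    rewrite -powR_mulrn ?addr_ge0//; apply: ler_powR; first exact: h1.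
    rewrite /c opprD -addrA -mulNr.
    have t1 : - theta * m%:R <= m%:R by rewrite ler_piMl// lerNl.
    have K0 : 0 <= K%:R :> R by [].
    by move: e0; lra.
  by rewrite lerXn2r ?nnegrE ?addr_ge0 ?lerD2l// ltW.
- by move=> k _; exact: cvg_mixture.
- by apply: summable_mixture => //; rewrite addr_ge0// ltW.
- move=> x /andP[x0 xX].
  have x1 : 0 < 1 + x by rewrite (lt_le_trans _ (h1 _ x0)).
  have y01 : 0 <= rho * (1 + x) `^ (- theta) < 1.
    rewrite mulr_ge0 ?powR_ge0 ?(ltW rho0)//=.
    apply: le_lt_trans rX; rewrite ler_wpM2l ?(ltW rho0)//.
    apply: (@le_trans _ _ (1 + x)); last by rewrite lerD2l.
    by apply: ler1_powR; [exact: h1|rewrite lerNl].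
  rewrite (_ : (fun m => _) = (1 + x) `^ (- e) *:
    (fun m => (-1) ^+ m * pochhammer mu m / m`!%:R *
      (rho * (1 + x) `^ (- theta)) ^+ m)); last first.
    apply/funext => m; rewrite /GRing.scale/= /mixture_coef exprMn.
    rewrite /c opprD -mulNr powRD; last by rewrite (gt_eqF x1) implybT.
    by rewrite powRrM powR_mulrn ?powR_ge0// -[RHS]/(_ * _); ring.
  by rewrite seriesZ; apply: cvgZl_tmp; exact: cvg_binomial_series.
Qed.

End binomial_mixture.

Lemma calP_term_lt1E (R : realType) (alpha xi mu : R) (k : nat) :
  0 <= alpha -> 0 <= mu ->
  calP_term_lt1 alpha xi mu k = fun m => mixture_coef mu xi m *
    pochhammer (alpha * mu + 1 + alpha * m%:R) k.
Proof.
move=> alpha0 mu0; apply/funext => m; rewrite /calP_term_lt1 /mixture_coef.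
rewrite Gamma_ratio; last by rewrite lerDr mulr_ge0// addr_ge0.
have -> : alpha * (m%:R + mu) + 1 = alpha * mu + 1 + alpha * m%:R by ring.
by congr (_ * _); rewrite mulrAC.
Qed.

(* The sign [(-1) ^+ k] cancels against the one in front of the series in
   [calP]. *)
Lemma calP_term_gt1E (R : realType) (alpha xi mu : R) (k : nat) :
  calP_term_gt1 alpha xi mu k = (-1) ^+ k *:
    (fun m => mixture_coef mu xi^-1 m * pochhammer (1 + - alpha * m%:R) k : R).
Proof.
apply/funext => m; rewrite -[RHS]/(_ * _) /calP_term_gt1 /mixture_coef.
have -> : \prod_(1 <= i < k.+1) (alpha * m%:R - i%:R) =
    (-1) ^+ k * pochhammer (1 + - alpha * m%:R) k.
  rewrite big_add1 big_mkord /pochhammer -[in (-1) ^+ k](card_ord k) -prodrN.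
  by apply: eq_bigr => i _; rewrite -natr1; ring.
by rewrite exprVn mulrCA; congr (_ * _); congr (_ * _); rewrite mulrAC.
Qed.

Lemma is_cvg_calP_term_lt1 (R : realType) (alpha xi mu : R) (k : nat) :
  0 < alpha <= 1 -> 0 < xi < 1 -> 0 <= mu ->
  cvgn (series (calP_term_lt1 alpha xi mu k)).
Proof.
move=> /andP[a0 a1] xi01 mu0; rewrite calP_term_lt1E// ?ltW//.
apply: cvg_mixture => //; first by rewrite addr_ge0// mulr_ge0// ltW.
by rewrite ger0_norm// ltW.
Qed.

Lemma is_cvg_calP_term_gt1 (R : realType) (alpha xi mu : R) (k : nat) :
  0 < alpha <= 1 -> 1 < xi -> 0 <= mu ->
  cvgn (series (calP_term_gt1 alpha xi mu k)).
Proof.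
move=> /andP[a0 a1] xi1 mu0; have xi0 : 0 < xi by rewrite (lt_trans _ xi1).
rewrite calP_term_gt1E; apply: is_cvg_seriesZ; apply: cvg_mixture => //.
- by rewrite invr_gt0 xi0 invf_lt1.
- by rewrite normrN ger0_norm// ltW.
Qed.

(* The generating function of [P(J_n <= t)] at [u = - x], with [mu = n nu] and
   without the factor [u ^+ n]. *)
Definition cdf_gf (R : realType) (alpha xi mu x : R) : R :=
  xi `^ mu / ((1 + x) * (xi + (1 + x) `^ alpha) `^ mu).

Lemma expands_cdf_gf (R : realType) (alpha xi mu : R) (K : nat) :
  0 < alpha <= 1 -> 0 < xi -> xi < 1 \/ 1 < xi -> 0 <= mu ->
  expands (cdf_gf alpha xi mu) (\poly_(k < K) calP alpha xi mu (Posz k)) K.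
Proof.
move=> /andP[a0 a1] xi0 xi1 mu0.
have a2 : `|alpha| <= 1 by rewrite ger0_norm// ltW.
case: xi1 => xi1.
- have xi01 : 0 < xi < 1 by rewrite xi0.
  have e0 : 0 <= alpha * mu + 1 by rewrite addr_ge0// mulr_ge0// ltW.
  have := expandsM (expandsC (xi `^ mu) K) (expands_mixture mu0 xi01 e0 a2 K).
  have -> : \poly_(k < K) calP alpha xi mu (Posz k) = (xi `^ mu)%:P *
      \poly_(k < K) (limn (series (fun m => mixture_coef mu xi m *
        pochhammer (alpha * mu + 1 + alpha * m%:R) k)) / k`!%:R).
    apply/polyP => k; rewrite coefCM !coef_poly; case: ifP => _; last by rewrite mulr0.
    by rewrite /calP xi1 calP_term_lt1E// ?ltW// mulrAC mulrA.
  apply: eq_expands => x x0.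
  have x1 : 0 < 1 + x by rewrite ltr_pwDl.
  have p0 : 0 < (1 + x) `^ alpha by rewrite powR_gt0.
  (* Here (1 + x)^alpha is factored out; its power - alpha mu joins 1 / (1 + x) in e = alpha mu + 1,
     and xi^mu remains as a prefactor. *)
  have -> : 1 + xi * (1 + x) `^ (- alpha) =
      (1 + x) `^ (- alpha) * (xi + (1 + x) `^ alpha).
    by rewrite powRN; field; rewrite gt_eqF.
  rewrite /cdf_gf powRM ?powR_ge0 ?addr_ge0 ?powR_ge0 ?(ltW xi0)//.
  rewrite -powRrM mulrNN opprD powRD; last by rewrite (gt_eqF x1) implybT.
  have xm : (1 + x) `^ (alpha * mu) != 0 by rewrite gt_eqF// powR_gt0.
  have xs : (xi + (1 + x) `^ alpha) `^ mu != 0 by rewrite gt_eqF// powR_gt0// addr_gt0.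
  rewrite !powRN powRr1 ?(ltW x1)//.
  by field; rewrite xm xs gt_eqF.
- have xi01 : 0 < xi^-1 < 1 by rewrite invr_gt0 xi0 invf_lt1.
  have a3 : `|- alpha| <= 1 by rewrite normrN.
  have := expands_mixture mu0 xi01 ler01 a3 K.
  have -> : \poly_(k < K) calP alpha xi mu (Posz k) =
      \poly_(k < K) (limn (series (fun m => mixture_coef mu xi^-1 m *
        pochhammer (1 + - alpha * m%:R) k)) / k`!%:R).
    apply/polyP => k; rewrite !coef_poly; case: ifP => // _.
    rewrite /calP ltNge (ltW xi1)/= calP_term_gt1E lim_seriesZ; last first.
      exact: cvg_mixture.
    rewrite -[X in _ * X]/(_ * _) mulrACA -exprMn mulrNN mulr1 expr1n.
    by rewrite mul1r mulrC.
  apply: eq_expands => x x0.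
  have x1 : 0 < 1 + x by rewrite ltr_pwDl.
  have p0 : 0 < (1 + x) `^ alpha by rewrite powR_gt0.
  (* Here xi is factored out: its power cancels xi^mu, and only 1 / (1 + x) is left, so e = 1. *)
  have -> : 1 + xi^-1 * (1 + x) `^ (- - alpha) =
      xi^-1 * (xi + (1 + x) `^ alpha).
    by rewrite opprK; field; rewrite gt_eqF.
  rewrite /cdf_gf powRM ?addr_ge0 ?powR_ge0 ?invr_ge0 ?(ltW xi0)//.
  have xs : (xi + (1 + x) `^ alpha) `^ mu != 0 by rewrite gt_eqF// powR_gt0// addr_gt0.
  rewrite -(powR_inv1 (ltW xi0)) -powRrM mulrNN mul1r.
  rewrite !powRN powRr1 ?(ltW x1)//.
  by field; rewrite xs gt_eqF.
Qed.

(** * Expectations of functions of a discrete random variable *)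

Section discrete_expectation.
Variables (R : realType) (d : measure_display) (Omega : measurableType d)
  (P : probability Omega R).
Implicit Types (Z : {RV P >-> nat}).

Definition nat_pmf Z (k : nat) : R := fine (P (Z @^-1` [set k])).

Lemma nat_pmfE Z k : (nat_pmf Z k)%:E = P (Z @^-1` [set k]).
Proof.
rewrite /nat_pmf fineK//; apply: fin_num_measure.
by rewrite -[X in measurable X]setTI; exact: measurable_funPT.
Qed.

Lemma measurable_nat_comp Z (g : nat -> R) :
  measurable_fun [set: Omega] (fun w => g (Z w)).
Proof. by apply: measurableT_comp => //; exact: measurable_funPT. Qed.

Lemma integrable_nat_comp Z (g : nat -> R) (B : R) : (forall k, `|g k| <= B) ->
  P.-integrable [set: Omega] (EFin \o (fun w => g (Z w))).
Proof.
move=> gB; apply: measurable_bounded_integrable => //.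
- by have h : (P setT < +oo)%E by rewrite probability_setT ltry.
- exact: measurable_nat_comp.
- exists B; split; first by rewrite num_real.
  by move=> x Bx w _; apply: (le_trans (gB _)); exact: ltW.
Qed.

Lemma Rintegral_nat_sum Z (a : nat -> R) K :
  \int[P]_w (\sum_(k < K) a k * (Z w == k)%:R) = \sum_(k < K) a k * nat_pmf Z k.
Proof.
have b1 k j : `|(j == k :> nat)%:R : R| <= 1 by case: (j == k); rewrite ?normr1 ?normr0.
have i1 k : P.-integrable [set: Omega] (EFin \o (fun w => a k * (Z w == k)%:R)).
  apply: (@integrable_nat_comp Z (fun j => a k * (j == k)%:R) `|a k|) => j.
  by rewrite normrM ler_piMr.
elim: K => [|K IH].
  under eq_Rintegral do rewrite big_ord0.
  by rewrite big_ord0 Rintegral_cst// mul0r.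
under eq_Rintegral do rewrite big_ord_recr/=.
rewrite RintegralD//.
- rewrite IH big_ord_recr/=; congr (_ + _); rewrite RintegralZl//.
    congr (_ * _); rewrite /Rintegral /nat_pmf; congr fine.
    rewrite -[X in _ = P X]setIT -integral_indic//; last first.
      by rewrite -[X in measurable X]setTI; exact: measurable_funPT.
    apply: eq_integral => w _; rewrite indicE; congr ((_ %:R)%:E); congr nat_of_bool.
    by apply/idP/idP => [/eqP h|]; [rewrite inE/= h|rewrite inE/= => ->].
  exact: (@integrable_nat_comp Z (fun j => (j == K)%:R) 1).
- apply: (@integrable_nat_comp Z (fun j => \sum_(k < K) a k * (j == k)%:R)
    (\sum_(k < K) `|a k|)) => j.
  rewrite (le_trans (ler_norm_sum _ _ _))//; apply: ler_sum => k _.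
  by rewrite normrM ler_piMr.
Qed.

(** The error is the expectation of [h (Z w)], where [h j] vanishes for j < K and equals (- x)^j
    otherwise; its modulus is at most x^K because x <= 1. *)
Lemma expands_expectation Z (g : R -> R) K :
  (forall x, 0 <= x <= 1 -> 'E_P[fun w => ((- x) ^+ Z w)%R]%E = (g x)%:E) ->
  expands g (\poly_(k < K) nat_pmf Z k) K.
Proof.
move=> gE; exists 1, 1; split=> // x x01; rewrite mul1r.
have /andP[x0 x1] := x01.
have gE' : g x = \int[P]_w ((- x) ^+ Z w).
  by rewrite /Rintegral -[LHS]/(fine (g x)%:E) -gE// unlock.
have xk k : `|(- x) ^+ k| <= 1 by rewrite normrX normrN exprn_ile1// ger0_norm.
have b1 k j : `|(j == k :> nat)%:R : R| <= 1 by case: (j == k); rewrite ?normr1 ?normr0.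
have e : (\poly_(k < K) nat_pmf Z k).[- x] =
    \int[P]_w (\sum_(k < K) (- x) ^+ k * (Z w == k)%:R).
  by rewrite Rintegral_nat_sum horner_poly; apply: eq_bigr => k _; rewrite mulrC.
rewrite gE' e -RintegralB//; last 2 first.
- exact: (@integrable_nat_comp Z (fun k => (- x) ^+ k) 1).
- apply: (@integrable_nat_comp Z (fun j => \sum_(k < K) (- x) ^+ k * (j == k)%:R)
    (\sum_(k < K) 1)) => j.
  rewrite (le_trans (ler_norm_sum _ _ _))//; apply: ler_sum => k _.
  by rewrite normrM -[leRHS]mul1r ler_pM.
pose h j := (- x) ^+ j - \sum_(k < K) (- x) ^+ k * (j == k)%:R.
have hK j : `|h j| <= x ^+ K.
  rewrite /h; have [jK|Kj] := ltnP j K.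
    rewrite (bigD1 (Ordinal jK))//= eqxx mulr1 big1 ?addr0 ?subrr ?normr0 ?exprn_ge0//.
    by move=> i /eqP ij; case: eqP => [ji|_]; [case: ij; exact/val_inj|rewrite mulr0].
  rewrite big1 ?subr0; last first.
    by move=> i _; rewrite gtn_eqF ?mulr0// (leq_trans _ Kj).
  by rewrite normrX normrN ger0_norm// ler_wiXn2l.
have ih := @integrable_nat_comp Z h _ hK.
apply: (le_trans (le_normr_Rintegral measurableT ih)).
apply: (@le_trans _ _ (\int[P]_(w in setT) (x ^+ K))).
  apply: le_Rintegral => //.
  - apply: (@integrable_nat_comp Z (fun j => `|h j|) (x ^+ K)) => j.
    by rewrite normr_id.
  - by apply: (@integrable_nat_comp Z (fun=> x ^+ K) `|x ^+ K|).
apply: (@le_trans _ _ (x ^+ K * fine (P setT))); last first.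
  by rewrite probability_setT/= mulr1.
by rewrite Rintegral_cst.
Qed.

End discrete_expectation.

(** * The distribution of the arrival times *)

Section arrival.
Variables (R : realType) (d : measure_display) (Omega : measurableType d)
  (P : probability Omega R) (Z : nat -> {RV P >-> nat}).
Hypothesis indZ : mutually_independent Z.
Hypothesis idZ : identically_distributed Z.

Lemma measurable_nat_preimage j (A : set nat) : measurable (Z j @^-1` A).
Proof. by rewrite -[X in measurable X]setTI; exact: measurable_funPT. Qed.

Let p (k : nat) : R := nat_pmf (Z 0) k.

Lemma identical_pmf j k : P (Z j @^-1` [set k]) = (p k)%:E.
Proof. by rewrite nat_pmfE; exact: idZ. Qed.

Definition arrival_path n K (f : {ffun 'I_n -> 'I_K.+1}) : set Omega :=
  [set w | forall j : 'I_n, Z j w = f j].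

Lemma arrival_pathE n K (f : {ffun 'I_n -> 'I_K.+1}) :
  arrival_path f = \bigcap_(j in [set` [fset x in iota 0 n]%fset])
    (* Independence takes a family of sets indexed by all naturals; this encoding gives the full set
       for j >= n. *)
    (Z j @^-1` [set k | forall i : 'I_n, val i = j -> k = f i :> nat]).
Proof.
apply/seteqP; split => [w wf j /=|w wf j].
  by move=> _ i <-; exact: wf.
apply: (wf j) => //=.
by rewrite !inE/= mem_iota/=.
Qed.

Lemma measurable_arrival_path n K (f : {ffun 'I_n -> 'I_K.+1}) :
  measurable (arrival_path f).
Proof.
rewrite arrival_pathE; apply: bigcap_measurableType => j _.
exact: measurable_nat_preimage.
Qed.

Lemma arrival_path_prob n K (f : {ffun 'I_n -> 'I_K.+1}) :
  P (arrival_path f) = (\prod_(j < n) p (f j))%:E.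
Proof.
rewrite arrival_pathE indZ// (perm_big (iota 0 n))/=; last first.
  apply: uniq_perm; rewrite ?fset_uniq ?iota_uniq// => x.
  by rewrite !inE.
rewrite -[n in iota 0 n]subn0 -/(index_iota 0 n) big_mkord -prodEFin.
apply: eq_bigr => j _.
rewrite -(identical_pmf j); congr (P _); apply/seteqP; split => w /= h; first exact: h.
by move=> i /val_inj ->.
Qed.

Definition paths_le n t : seq {ffun 'I_n -> 'I_t.+1} :=
  [seq f : {ffun 'I_n -> 'I_t.+1} <- enum {ffun 'I_n -> 'I_t.+1} | (\sum_(j < n) f j <= t)%N].

Lemma arrival_le_bigcup n t : [set w | (arrival Z n w <= t)%N] =
  \bigcup_(f in [set` paths_le n t]) arrival_path f.
Proof.
apply/seteqP; split => w /=.
- move=> wt; have Zt j : (j < n)%N -> (Z j w < t.+1)%N.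
    move=> jn; rewrite ltnS (leq_trans _ wt)// /arrival.
    by rewrite (bigD1 (Ordinal jn))//= leq_addr.
  exists [ffun j : 'I_n => Ordinal (Zt j (ltn_ord j))] => /=.
    rewrite mem_filter mem_enum andbT; apply: leq_trans wt.
    by rewrite /arrival; apply: leq_sum => j _; rewrite ffunE.
  by move=> j; rewrite ffunE.
- move=> [f]; rewrite /= mem_filter => /andP[ft _] wf.
  by rewrite /arrival (eq_bigr (fun j => val (f j))).
Qed.

Lemma measurable_arrival n t : measurable [set w | (arrival Z n w <= t)%N].
Proof.
rewrite arrival_le_bigcup; apply: fin_bigcup_measurable => // f _.
exact: measurable_arrival_path.
Qed.

(** The event is a finite disjoint union of paths, as no waiting time can exceed a total <= t. Path
    probabilities are products by independence, so they are the terms of the expanded n-th power;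
    multiplying by the truncated geometric series adds up the coefficients of degree <= t. *)
Lemma arrival_cdf n t : P [set w | (arrival Z n w <= t)%N] =
  (((\poly_(k < t.+1) p k) ^+ n * \poly_(k < t.+1) 1)`_t)%:E.
Proof.
rewrite arrival_le_bigcup.
rewrite measure_fin_bigcup//; last 2 first.
- move=> f g _ _ [w [wf wg]]; apply/ffunP => j; apply: val_inj.
  by rewrite /= -wf -wg.
- by move=> f _; exact: measurable_arrival_path.
transitivity (\sum_(f <- paths_le n t) P (arrival_path f))%E.
  exact/esym/fsbig_seq/filter_uniq/enum_uniq.
rewrite big_filter big_enum_cond/=.
under eq_bigr do rewrite arrival_path_prob.
rewrite sumEFin; congr EFin.
have -> : (\poly_(k < t.+1) p k) ^+ n = \sum_(f : {ffun 'I_n -> 'I_t.+1})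
    (\prod_(j < n) p (f j)) *: 'X^(\sum_(j < n) f j).
  rewrite poly_def -[n in LHS]card_ord -prodr_const bigA_distr_bigA.
  by apply: eq_bigr => f _; rewrite scaler_prod prodrXr.
rewrite mulr_suml coef_sum [LHS]big_mkcond/=.
apply: eq_bigr => f _; rewrite -scalerAl coefZ coefXnM ltnNge.
case: ifP => _ /=; last by rewrite mulr0.
by rewrite coef_poly ltnS leq_subr mulr1.
Qed.

Lemma state_probabilityE n t : state_probability Z n t =
  (P [set w | (arrival Z n w <= t)%N] - P [set w | (arrival Z n.+1 w <= t)%N])%E.
Proof.
have sub : [set w | (arrival Z n.+1 w <= t)%N] `<=` [set w | (arrival Z n w <= t)%N].
  by move=> w /=; apply: leq_trans; rewrite /arrival big_ord_recr/= leq_addr.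
rewrite /state_probability -[in X in (_ - X)%E](setIidr sub) -measureD.
- congr (P _); apply/seteqP; split => w /=; rewrite ltnNge.
    by move=> /andP[-> /negP].
  by move=> [-> /negP ->].
- exact: measurable_arrival.
- exact: measurable_arrival.
- apply: (le_lt_trans (probability_le1 P _)); rewrite ?ltry//.
  exact: measurable_arrival.
Qed.

End arrival.

(** * Generating functions on the negative real axis *)

Local Open Scope complex_scope.

Lemma cpow_real (R : realType) (a b : R) : 0 < a -> cpow a%:C b = (a `^ b)%:C.
Proof.
move=> a0.
have na : ComplexField.Normc.normc a%:C = a.
  by rewrite /= expr0n/= addr0 sqrtr_sqr gtr0_norm.
rewrite /cpow /carg na /= lexx divff ?gt_eqF// acos1 mulr0 cos0 sin0.
by rewrite -[RHS]mulr1.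
Qed.

(** At u = - x <= 0 both complex powers have positive real bases, so the principal branches reduce
    to real powers. *)
Lemma pdtp_gf_real (R : realType) (alpha nu xi x : R) : 0 < xi -> 0 <= x ->
  pdtp_gf alpha nu xi (- x)%:C =
  (xi `^ nu * - x / (xi + (1 + x) `^ alpha) `^ nu)%:C.
Proof.
move=> xi0 x0; have x1 : 0 < 1 + x by rewrite ltr_pwDl.
have e : 1 - (- x)%:C = (1 + x)%:C by rewrite rmorphN opprK rmorphD.
rewrite /pdtp_gf e.
rewrite cpow_real// -rmorphD cpow_real ?addr_gt0 ?powR_gt0//.
by rewrite !rmorphM fmorphV.
Qed.

Lemma expectation_real (R : realType) (d : measure_display)
    (Omega : measurableType d) (P : probability Omega R)
    (Z : {RV P >-> nat}) (g : R[i] -> R[i]) (x : R) :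
  has_generating_function Z g -> `|x| <= 1 ->
  'E_P[fun w => (x ^+ Z w)%R]%E = (complex.Re (g x%:C))%:E.
Proof.
move=> gZ x1; have xC : `|x%:C| <= 1.
  by rewrite normc_def/= expr0n addr0 sqrtr_sqr lecR.
have [<- _] := gZ _ xC; congr expectation; apply/funext => w.
by rewrite -rmorphXn.
Qed.

Lemma expands_inv1D (R : realType) K :
  expands (fun x : R => (1 + x)^-1) (\poly_(k < K) 1) K.
Proof.
exists 1, 1; split=> // x /andP[x0 x1]; rewrite mul1r.
have x1p : 0 < 1 + x by rewrite ltr_pwDl.
have -> : (1 + x)^-1 - (\poly_(k < K) (1 : R)).[- x] = (- x) ^+ K / (1 + x).
  rewrite horner_poly (eq_bigr (fun i : 'I_K => (- x) ^+ i)); last first.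
    by move=> i _; rewrite mul1r.
  have := subrX1 (- x) K.
  move: (\sum_(i < K) _) => S e.
  have -> : (- x) ^+ K = 1 - (1 + x) * S by rewrite -[LHS](subrK 1) e; ring.
  by field; rewrite gt_eqF.
rewrite normrM normrX normrN (ger0_norm x0) normfV gtr0_norm//.
by rewrite ler_piMr ?exprn_ge0// invf_le1// lerDl.
Qed.

(** * State probabilities of the PDTP *)

Section PDTP.
Variables (R : realType) (d : measure_display) (Omega : measurableType d)
  (P : probability Omega R) (alpha nu xi : R) (Z : nat -> {RV P >-> nat}).
Hypotheses (alpha01 : 0 < alpha <= 1) (nu0 : 0 < nu) (xi0 : 0 < xi)
  (hZ : is_PDTP alpha nu xi Z).

(** The convention that [calP] vanishes at negative integers matches the vanishing of the
    coefficients of degree below n in a multiple of ['X^n]. *)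
Lemma coef_shift_calP (mu : R) n t :
  calP alpha xi mu (t%:Z - n%:Z) =
  ('X^n * \poly_(k < t.+1) calP alpha xi mu (Posz k))`_t.
Proof.
rewrite coefXnM; case: ltnP => tn.
  have -> : t%:Z - n%:Z = Negz (n - t).-1 by lia.
  by [].
by rewrite coef_poly ltnS leq_subr subzn.
Qed.

(** Both sides are coefficients of degree t in expansions, modulo degree t + 1, of the same function
    f(x)^n / (1 + x) = (- x)^n [cdf_gf]; such coefficients are unique. *)
Lemma arrival_cdf_calP n t : xi < 1 \/ 1 < xi ->
  P [set w | (arrival Z n w <= t)%N] =
  (calP alpha xi (n%:R * nu) (t%:Z - n%:Z))%:E.
Proof.
move=> xi1.
rewrite (arrival_cdf (pdtp_independent hZ) (pdtp_identical hZ)).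
rewrite coef_shift_calP; congr EFin.
pose f (x : R) := xi `^ nu * - x / (xi + (1 + x) `^ alpha) `^ nu.
have fE x : 0 <= x <= 1 -> 'E_P[fun w => ((- x) ^+ Z 0 w)%R]%E = (f x)%:E.
  move=> /andP[x0 x1]; rewrite (expectation_real (pdtp_generating hZ 0)).
    by rewrite pdtp_gf_real.
  by rewrite normrN ger0_norm.
have h1 := expandsM (expandsXn n (expands_expectation t.+1 fE)) (expands_inv1D R t.+1).
apply: expands_uniq (ltnSn t) => //; first exact: h1.
have mu0 : 0 <= n%:R * nu by rewrite mulr_ge0// ltW.
have hX : expands (fun x : R => - x) 'X t.+1.
  by exists 0, 1; split=> // x _; rewrite hornerX subrr normr0 mul0r.
have h2 := expandsM (expandsXn n hX) (expands_cdf_gf t.+1 alpha01 xi0 xi1 mu0).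
apply: eq_expands h2 => x x0.
rewrite /cdf_gf /f mulrC.
rewrite -[n%:R * nu]mulrC !powRrM !powR_mulrn ?powR_ge0//.
have x1 : 1 + x != 0 by rewrite gt_eqF// ltr_pwDl.
have s0 : (xi + (1 + x) `^ alpha) `^ nu != 0.
  by rewrite gt_eqF// powR_gt0// addr_gt0// powR_gt0// ltr_pwDl.
rewrite !exprMn exprVn.
have s1 := expf_neq0 n s0.
by field; rewrite x1 s1.
Qed.

Lemma leq_arrival n w : (n <= arrival Z n w)%N.
Proof.
rewrite /arrival -[n in leqLHS]card_ord -sum1_card.
by apply: leq_sum => j _; exact: pdtp_positive hZ j w.
Qed.

Lemma state_probability_lt n t : (t < n)%N -> state_probability Z n t = 0%E.
Proof.
move=> tn; rewrite /state_probability [X in P X](_ : _ = set0) ?measure0//.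
apply/seteqP; split => w //= /andP[wt _].
by have := leq_trans (leq_arrival n w) wt; rewrite leqNgt tn.
Qed.

Lemma state_probability0 n : state_probability Z n 0 = ((n == 0%N)%:R)%:E.
Proof.
case: n => [|n]; last by rewrite state_probability_lt.
rewrite /state_probability [X in P X](_ : _ = setT) ?probability_setT//.
apply/seteqP; split => w //= _; rewrite {1}/arrival big_ord0 leqnn/=.
exact: leq_arrival 1 w.
Qed.

End PDTP.

Local Close Scope complex_scope.

Theorem mainTheorem4 (R : realType) (d : measure_display)
    (Omega : measurableType d) (P : probability Omega R)
    (alpha nu xi : R) (Z : nat -> {RV P >-> nat})
    (halpha : 0 < alpha <= 1) (hnu : 0 < nu) (hxi : 0 < xi)
    (hZ : is_PDTP alpha nu xi Z) :
  (* the series defining [calP] converge *)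
  (forall (mu : R) (k : nat), 0 <= mu ->
     (xi < 1 -> cvgn (series (calP_term_lt1 alpha xi mu k))) /\
     (1 < xi -> cvgn (series (calP_term_gt1 alpha xi mu k)))) /\
  (xi < 1 \/ 1 < xi ->
     forall n t : nat,
       state_probability Z n t =
       (calP alpha xi (n%:R * nu) (t%:Z - n%:Z) -
        calP alpha xi (n.+1%:R * nu) (t%:Z - n%:Z - 1))%:E) /\
  (forall n t : nat, (t < n)%N -> state_probability Z n t = 0%E) /\
  (forall n : nat, state_probability Z n 0 = ((n == 0%N)%:R)%:E).
Proof.
split=> [mu k mu0|].
  split=> xi1; last exact: is_cvg_calP_term_gt1.
  by apply: is_cvg_calP_term_lt1; rewrite ?hxi.
split=> [xi1 n t|].
  rewrite state_probabilityE EFinB; congr (_ - _)%E.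
    exact: (arrival_cdf_calP halpha hnu hxi hZ).
  rewrite (arrival_cdf_calP halpha hnu hxi hZ)//; congr (calP _ _ _ _)%:E.
  lia.
split=> [n t|n]; first exact: (state_probability_lt hZ).
exact: (state_probability0 hZ).
Qed.
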